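(* Let $\mathbf C$ be a category with finite coproducts. The category of $\omega$-iteratable Elgot monads on $\mathbf C$ (with iteration-preserving monad morphisms) is isomorphic to the full subcategory of the category of Eilenberg–Moore algebras of the monad $(-)^\nu$ on $\omega$-iteratable monads consisting of those algebras $(\mathbb S,\rho\colon\mathbb S^\nu\to\mathbb S)$ satisfying the delay cancellation condition $\rho\circ\rhd=\rho$.
   Context: For a monad $\mathbb T$ on $\mathbf C$ (unit $\eta$, Kleisli lifting $(-)^*$), $T^\nu X=\nu\gamma.\,T(X+\gamma)$ denotes the final coalgebra of $\gamma\mapsto T(X+\gamma)$, with structure $\mathrm{out}$ (an isomorphism) and coiteration $\mathrm{coit}$ (the unique coalgebra morphism into it). When these exist for all $X$, $\mathbb T^\nu$ is a monad with unit $\eta^\nu=\mathrm{out}^{-1}\circ\eta\circ\mathrm{inl}$ and Kleisli lifting $f^\ddagger$ of $f\colon X\to T^\nu Y$ determined by $\mathrm{out}\circ f^\ddagger=[\mathrm{out}\circ f,\eta\circ\mathrm{inr}\circ f^\ddagger]^*\circ\mathrm{out}$. A monad (or functor) $T$ is 1-iteratable if $T^\nu$ exists, $(n+1)$-iteratable if $T^\nu$ is $n$-iteratable, and $\omega$-iteratable if $n$-iteratable for all $n$. On the category of $\omega$-iteratable monads and monad morphisms, $\mathbb T\mapsto\mathbb T^\nu$ is a monad, acting on a monad morphism $\alpha$ by $\alpha^\nu=\mathrm{coit}(\alpha\circ\mathrm{out})$, with unit $\boldsymbol\eta_X=\mathrm{out}^{-1}\circ T(\mathrm{inl})\colon TX\to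 T^\nu X$ and multiplication $\boldsymbol\mu_X=\mathrm{coit}(T[\mathrm{id},\mathrm{inr}\circ\mathrm{out}^{-1}]\circ\mathrm{out}\circ\mathrm{out})\colon T^{\nu\nu}X\to T^\nu X$. An algebra is $(\mathbb S,\rho)$ with $\rho\colon\mathbb S^\nu\to\mathbb S$ a monad morphism, $\rho\circ\boldsymbol\eta=\mathrm{id}$ and $\rho\circ\boldsymbol\mu=\rho\circ\rho^\nu$; algebra morphisms are monad morphisms $\alpha$ with $\alpha\circ\rho=\rho'\circ\alpha^\nu$. The delay transformation is $\rhd=\mathrm{out}^{-1}\circ\eta\circ\mathrm{inr}\colon S^\nu\to S^\nu$. An Elgot monad is a monad $\mathbb S$ with an operator assigning to every $f\colon X\to S(Y+X)$ a morphism $f^\dagger\colon X\to SY$ such that: fixpoint $f^\dagger=[\eta,f^\dagger]^*\circ f$; naturality $g^*\circ f^\dagger=([S(\mathrm{inl})\circ g,\eta\circ\mathrm{inr}]^*\circ f)^\dagger$ for $g\colon Y\to SZ$; codiagonal $(S[\mathrm{id},\mathrm{inr}]\circ f)^\dagger=(f^\dagger)^\dagger$ for $f\colon X\to S((Y+X)+X)$; uniformity: $f\circ h=S(\mathrm{id}+h)\circ g$ implies $f^\dagger\circ h=g^\dagger$ for $g\colon Z\to S(Y+Z)$, $h\colon Z\to X$. Morphisms of Elgot monads are monad morphisms $\alpha$ with $\alpha\circ f^\dagger=(\alpha\circ f)^\dagger$. *)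

(* Defs.v *)
From Stdlib Require Import ClassicalEpsilon FunctionalExtensionality ProofIrrelevance.

Set Implicit Arguments.
Unset Strict Implicit.
Unset Printing Implicit Defensive.

Declare Scope cat_scope.
Open Scope cat_scope.

Reserved Notation "g \o f" (at level 40, left associativity).

Record Category := MkCategory {
  ob :> Type;
  hom : ob -> ob -> Type;
  idm : forall X, hom X X;
  comp : forall X Y Z, hom Y Z -> hom X Y -> hom X Z;
  comp_id_l : forall X Y (f : hom X Y), comp (idm Y) f = f;
  comp_id_r : forall X Y (f : hom X Y), comp f (idm X) = f;
  comp_assoc : forall W X Y Z (h : hom Y Z) (g : hom X Y) (f : hom W X),
    comp (comp h g) f = comp h (comp g f)
}.

Arguments hom {c} _ _.
Arguments idm {c} X.
Arguments comp {c X Y Z} _ _.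

Notation "g \o f" := (comp g f) : cat_scope.

Record Functor (A B : Category) := MkFunctor {
  fobj :> A -> B;
  fmap : forall X Y : A, hom X Y -> hom (fobj X) (fobj Y);
  fmap_id : forall X, fmap (idm X) = idm (fobj X);
  fmap_comp : forall X Y Z (g : hom Y Z) (f : hom X Y),
    fmap (g \o f) = fmap g \o fmap f
}.

Arguments fmap {A B} _ {X Y} _.

Definition functor_id (A : Category) : Functor A A :=
  @MkFunctor A A (fun X => X) (fun X Y f => f)
    (fun X => eq_refl) (fun X Y Z g f => eq_refl).

Lemma functor_comp_id (A B D : Category) (G : Functor B D) (F : Functor A B) X :
  fmap G (fmap F (idm X)) = idm (G (F X)).
Proof. rewrite fmap_id. apply fmap_id. Qed.

Lemma functor_comp_comp (A B D : Category) (G : Functor B D) (F : Functor A B)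
    X Y Z (g : hom Y Z) (f : hom X Y) :
  fmap G (fmap F (g \o f)) = fmap G (fmap F g) \o fmap G (fmap F f).
Proof. rewrite fmap_comp. apply fmap_comp. Qed.

Definition functor_comp (A B D : Category) (G : Functor B D) (F : Functor A B) :
    Functor A D :=
  @MkFunctor A D (fun X => G (F X)) (fun X Y f => fmap G (fmap F f))
    (functor_comp_id G F) (@functor_comp_comp A B D G F).

Definition isomorphic_categories (A B : Category) : Prop :=
  exists (F : Functor A B) (G : Functor B A),
    functor_comp G F = functor_id A /\ functor_comp F G = functor_id B.

Definition full_subcategory (A : Category) (P : A -> Prop) : Category :=
  @MkCategory {X : A | P X}
    (fun X Y => hom (proj1_sig X) (proj1_sig Y))
    (fun X => idm (proj1_sig X))
    (fun X Y Z g f => g \o f)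
    (fun X Y f => comp_id_l f)
    (fun X Y f => comp_id_r f)
    (fun W X Y Z h g f => comp_assoc h g f).

(* Monads as triples, used for [(-)^nu] on the category of omega-iteratable monads;
   the monads on the base category are the Kleisli triples [Monad] below. *)

Record TripleMonad (A : Category) := MkTripleMonad {
  tm_functor :> Functor A A;
  tm_unit : forall X : A, hom X (tm_functor X);
  tm_mult : forall X : A, hom (tm_functor (tm_functor X)) (tm_functor X);
  tm_unit_nat : forall (X Y : A) (f : hom X Y),
    fmap tm_functor f \o tm_unit X = tm_unit Y \o f;
  tm_mult_nat : forall (X Y : A) (f : hom X Y),
    fmap tm_functor f \o tm_mult X
      = tm_mult Y \o fmap tm_functor (fmap tm_functor f);
  tm_unit_l : forall X, tm_mult X \o tm_unit (tm_functor X) = idm _;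
  tm_unit_r : forall X, tm_mult X \o fmap tm_functor (tm_unit X) = idm _;
  tm_mult_assoc : forall X,
    tm_mult X \o tm_mult (tm_functor X) = tm_mult X \o fmap tm_functor (tm_mult X)
}.

Record EMAlgebra (A : Category) (M : TripleMonad A) := MkEMAlgebra {
  alg_carrier : A;
  alg_map : hom (M alg_carrier) alg_carrier;
  alg_unit : alg_map \o tm_unit M alg_carrier = idm alg_carrier;
  alg_mult : alg_map \o tm_mult M alg_carrier = alg_map \o fmap M alg_map
}.

Definition is_alg_morphism (A : Category) (M : TripleMonad A) (a b : EMAlgebra M)
    (f : hom (alg_carrier a) (alg_carrier b)) : Prop :=
  f \o alg_map a = alg_map b \o fmap M f.

Definition alg_hom (A : Category) (M : TripleMonad A) (a b : EMAlgebra M) : Type :=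
  {f : hom (alg_carrier a) (alg_carrier b) | is_alg_morphism f}.

Lemma sig_ext (T : Type) (P : T -> Prop) (x y : {t : T | P t}) :
  proj1_sig x = proj1_sig y -> x = y.
Proof. apply eq_sig_hprop. intros; apply proof_irrelevance. Qed.

Section EilenbergMoore.
Context (A : Category) (M : TripleMonad A).

Lemma alg_id_morphism (a : EMAlgebra M) :
  @is_alg_morphism A M a a (idm (alg_carrier a)).
Proof.
  unfold is_alg_morphism. now rewrite fmap_id, comp_id_l, comp_id_r.
Qed.

Lemma alg_comp_morphism (a b c : EMAlgebra M) (g : alg_hom b c) (f : alg_hom a b) :
  @is_alg_morphism A M a c (proj1_sig g \o proj1_sig f).
Proof.
  destruct g as [g Hg], f as [f Hf]; unfold is_alg_morphism in *; simpl.
  now rewrite fmap_comp, comp_assoc, Hf, <- !comp_assoc, Hg.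
Qed.

Definition alg_id (a : EMAlgebra M) : alg_hom a a :=
  exist _ (idm (alg_carrier a)) (alg_id_morphism a).

Definition alg_comp (a b c : EMAlgebra M) (g : alg_hom b c) (f : alg_hom a b) :
    alg_hom a c :=
  exist _ (proj1_sig g \o proj1_sig f) (alg_comp_morphism g f).

Lemma alg_comp_id_l (a b : EMAlgebra M) (f : alg_hom a b) : alg_comp (alg_id b) f = f.
Proof. apply sig_ext, comp_id_l. Qed.

Lemma alg_comp_id_r (a b : EMAlgebra M) (f : alg_hom a b) : alg_comp f (alg_id a) = f.
Proof. apply sig_ext, comp_id_r. Qed.

Lemma alg_comp_assoc (a b c d : EMAlgebra M)
    (h : alg_hom c d) (g : alg_hom b c) (f : alg_hom a b) :
  alg_comp (alg_comp h g) f = alg_comp h (alg_comp g f).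
Proof. apply sig_ext, comp_assoc. Qed.

Definition EM_category : Category :=
  @MkCategory (EMAlgebra M) (@alg_hom A M) alg_id alg_comp
    alg_comp_id_l alg_comp_id_r alg_comp_assoc.

End EilenbergMoore.

Record FiniteCoproducts (C : Category) := MkFiniteCoproducts {
  initial : C;
  from_initial : forall X : C, hom initial X;
  from_initial_unique : forall (X : C) (f : hom initial X), f = from_initial X;
  coprod : C -> C -> C;
  inl : forall X Y : C, hom X (coprod X Y);
  inr : forall X Y : C, hom Y (coprod X Y);
  copair : forall X Y Z : C, hom X Z -> hom Y Z -> hom (coprod X Y) Z;
  copair_inl : forall X Y Z (f : hom X Z) (g : hom Y Z), copair f g \o inl X Y = f;
  copair_inr : forall X Y Z (f : hom X Z) (g : hom Y Z), copair f g \o inr X Y = g;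
  copair_unique : forall X Y Z (f : hom X Z) (g : hom Y Z) (h : hom (coprod X Y) Z),
    h \o inl X Y = f -> h \o inr X Y = g -> h = copair f g
}.

Arguments coprod {C H} _ _ : rename.
Arguments inl {C H X Y} : rename.
Arguments inr {C H X Y} : rename.
Arguments copair {C H X Y Z} _ _ : rename.

Notation "[[ f , g ]]" := (copair f g) (at level 0) : cat_scope.

Record Monad (C : Category) := MkMonad {
  T_ob :> C -> C;
  eta : forall X : C, hom X (T_ob X);
  lift : forall X Y : C, hom X (T_ob Y) -> hom (T_ob X) (T_ob Y);
  lift_unit : forall X, lift (eta X) = idm (T_ob X);
  lift_eta : forall X Y (f : hom X (T_ob Y)), lift f \o eta X = f;
  lift_lift : forall X Y Z (g : hom Y (T_ob Z)) (f : hom X (T_ob Y)),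
    lift g \o lift f = lift (lift g \o f)
}.

Arguments eta {C T X} : rename.
Arguments lift {C T X Y} _ : rename.

Definition tmap (C : Category) (T : Monad C) (X Y : C) (f : hom X Y) :
    hom (T X) (T Y) := lift (eta \o f).

Record MonadMorphism (C : Category) (S T : Monad C) := MkMonadMorphism {
  mm :> forall X : C, hom (S X) (T X);
  mm_eta : forall X, mm X \o eta = eta;
  mm_lift : forall X Y (f : hom X (S Y)), mm Y \o lift f = lift (mm Y \o f) \o mm X
}.

Lemma monad_morphism_ext (C : Category) (S T : Monad C) (a b : MonadMorphism S T) :
  (forall X, a X = b X) -> a = b.
Proof.
  destruct a as [a a1 a2], b as [b b1 b2]; simpl; intros H.
  assert (a = b) by (now apply functional_extensionality_dep); subst b.
  f_equal; apply proof_irrelevance.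
Qed.

Section MonadCategory.
Context (C : Category).

Lemma mm_id_eta (T : Monad C) (X : C) : idm (T X) \o eta = eta.
Proof. apply comp_id_l. Qed.

Lemma mm_id_lift (T : Monad C) (X Y : C) (f : hom X (T Y)) :
  idm (T Y) \o lift f = lift (idm (T Y) \o f) \o idm (T X).
Proof. now rewrite !comp_id_l, comp_id_r. Qed.

Definition mm_id (T : Monad C) : MonadMorphism T T :=
  @MkMonadMorphism C T T (fun X => idm (T X)) (@mm_id_eta T) (@mm_id_lift T).

Lemma mm_comp_eta (R S T : Monad C) (b : MonadMorphism S T) (a : MonadMorphism R S) X :
  (b X \o a X) \o eta = eta.
Proof. now rewrite comp_assoc, !mm_eta. Qed.

Lemma mm_comp_lift (R S T : Monad C) (b : MonadMorphism S T) (a : MonadMorphism R S)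
    X Y (f : hom X (R Y)) :
  (b Y \o a Y) \o lift f = lift ((b Y \o a Y) \o f) \o (b X \o a X).
Proof.
  now rewrite comp_assoc, mm_lift, <- comp_assoc, mm_lift, !comp_assoc.
Qed.

Definition mm_comp (R S T : Monad C) (b : MonadMorphism S T) (a : MonadMorphism R S) :
    MonadMorphism R T :=
  @MkMonadMorphism C R T (fun X => b X \o a X)
    (mm_comp_eta b a) (@mm_comp_lift R S T b a).

Lemma mm_comp_id_l (S T : Monad C) (a : MonadMorphism S T) : mm_comp (mm_id T) a = a.
Proof. apply monad_morphism_ext; intros; apply comp_id_l. Qed.

Lemma mm_comp_id_r (S T : Monad C) (a : MonadMorphism S T) : mm_comp a (mm_id S) = a.
Proof. apply monad_morphism_ext; intros; apply comp_id_r. Qed.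

Lemma mm_comp_assoc (Q R S T : Monad C) (c : MonadMorphism S T) (b : MonadMorphism R S)
    (a : MonadMorphism Q R) :
  mm_comp (mm_comp c b) a = mm_comp c (mm_comp b a).
Proof. apply monad_morphism_ext; intros; apply comp_assoc. Qed.

Definition monad_category : Category :=
  @MkCategory (Monad C) (@MonadMorphism C) mm_id mm_comp
    mm_comp_id_l mm_comp_id_r mm_comp_assoc.

End MonadCategory.

Record FinalCoalgebra (C : Category) (F : Functor C C) := MkFinalCoalgebra {
  fc_carrier :> C;
  out : hom fc_carrier (F fc_carrier);
  coit : forall A : C, hom A (F A) -> hom A fc_carrier;
  out_coit : forall (A : C) (a : hom A (F A)), out \o coit a = fmap F (coit a) \o a;
  coit_unique : forall (A : C) (a : hom A (F A)) (h : hom A fc_carrier),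
    out \o h = fmap F h \o a -> h = coit a
}.

Arguments out {C F N} : rename.
Arguments coit {C F N A} _ : rename.

Definition out_inv (C : Category) (F : Functor C C) (N : FinalCoalgebra F) :
    hom (F N) N := coit (fmap F (out (N := N))).
Arguments out_inv {C F N}.

Lemma out_inv_out (C : Category) (F : Functor C C) (N : FinalCoalgebra F) :
  out_inv \o out (N := N) = idm N.
Proof.
  transitivity (coit (N := N) (out (N := N))).
  - apply coit_unique. unfold out_inv.
    now rewrite <- comp_assoc, out_coit, fmap_comp.
  - symmetry. apply coit_unique. now rewrite fmap_id, comp_id_l, comp_id_r.
Qed.

Lemma out_out_inv (C : Category) (F : Functor C C) (N : FinalCoalgebra F) :
  out \o out_inv (N := N) = idm (F N).
Proof.
  unfold out_inv at 1. rewrite out_coit, <- fmap_comp.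
  fold (@out_inv C F N). rewrite out_inv_out. apply fmap_id.
Qed.

Section Nu.
Context (C : Category) (H : FiniteCoproducts C).

Local Notation "X ⊕ Y" := (@coprod C H X Y)
  (at level 50, left associativity) : cat_scope.

Definition cosum (X X' Y Y' : C) (f : hom X X') (g : hom Y Y') :
    hom (X ⊕ Y) (X' ⊕ Y') := [[inl \o f, inr \o g]].

Lemma coprod_ext (X Y Z : C) (f g : hom (X ⊕ Y) Z) :
  f \o inl = g \o inl -> f \o inr = g \o inr -> f = g.
Proof.
  intros Hl Hr. rewrite (copair_unique Hl Hr). symmetry.
  now apply copair_unique.
Qed.

Lemma comp_copair (X Y Z W : C) (h : hom Z W) (f : hom X Z) (g : hom Y Z) :
  h \o [[f, g]] = @copair C H _ _ _ (h \o f) (h \o g).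
Proof.
  apply copair_unique; now rewrite comp_assoc, ?copair_inl, ?copair_inr.
Qed.

Lemma copair_inl_k (X Y Z W : C) (f : hom X Z) (g : hom Y Z) (k : hom W X) :
  @copair C H _ _ _ f g \o (inl \o k) = f \o k.
Proof. now rewrite <- comp_assoc, copair_inl. Qed.

Lemma copair_inr_k (X Y Z W : C) (f : hom X Z) (g : hom Y Z) (k : hom W Y) :
  @copair C H _ _ _ f g \o (inr \o k) = g \o k.
Proof. now rewrite <- comp_assoc, copair_inr. Qed.

Lemma lift_eta_k (T : Monad C) (X Y Z : C) (f : hom X (T Y)) (k : hom Z X) :
  lift f \o (eta \o k) = f \o k.
Proof. now rewrite <- comp_assoc, lift_eta. Qed.

Lemma lift_lift_k (T : Monad C) (X Y Z W : C)
    (g : hom Y (T Z)) (f : hom X (T Y)) (k : hom W (T X)) :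
  lift g \o (lift f \o k) = lift (lift g \o f) \o k.
Proof. now rewrite <- comp_assoc, lift_lift. Qed.

Lemma mm_eta_k (S T : Monad C) (a : MonadMorphism S T) (X Z : C) (k : hom Z X) :
  a X \o (eta \o k) = eta \o k.
Proof. now rewrite <- comp_assoc, mm_eta. Qed.

Lemma mm_lift_k (S T : Monad C) (a : MonadMorphism S T) (X Y Z : C)
    (f : hom X (S Y)) (k : hom Z (S X)) :
  a Y \o (lift f \o k) = lift (a Y \o f) \o (a X \o k).
Proof. now rewrite <- comp_assoc, mm_lift, comp_assoc. Qed.

Local Ltac cat :=
  unfold tmap, cosum;
  repeat first
    [ rewrite comp_assoc | rewrite comp_id_l | rewrite comp_id_r
    | rewrite comp_copair
    | rewrite copair_inl | rewrite copair_inr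
    | rewrite copair_inl_k | rewrite copair_inr_k
    | rewrite mm_eta | rewrite mm_eta_k | rewrite mm_lift | rewrite mm_lift_k
    | rewrite lift_eta | rewrite lift_eta_k
    | rewrite lift_lift | rewrite lift_lift_k ].

Local Ltac cext := repeat (apply coprod_ext); cat; try reflexivity.

Lemma cosum_id (X Y : C) : cosum (idm X) (idm Y) = idm (X ⊕ Y).
Proof. cext. Qed.

Lemma res_functor_id (T : Monad C) (X G : C) :
  tmap T (cosum (idm X) (idm G)) = idm (T (X ⊕ G)).
Proof. rewrite cosum_id. cat. apply lift_unit. Qed.

Lemma res_functor_comp (T : Monad C) (X G G' G'' : C) (g : hom G' G'') (f : hom G G') :
  tmap T (cosum (idm X) (g \o f)) = tmap T (cosum (idm X) g) \o tmap T (cosum (idm X) f).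
Proof. cat. reflexivity. Qed.

Definition res_functor (T : Monad C) (X : C) : Functor C C :=
  @MkFunctor C C (fun G => T (X ⊕ G)) (fun G G' f => tmap T (cosum (idm X) f))
    (res_functor_id T X) (@res_functor_comp T X).

Definition has_nu (T : Monad C) : Prop :=
  forall X : C, inhabited (FinalCoalgebra (res_functor T X)).

(* Iteratability is mere existence of final coalgebras; [nu h X] is a chosen one
   (final coalgebras are unique up to isomorphism). *)
Definition nu (T : Monad C) (h : has_nu T) (X : C) : FinalCoalgebra (res_functor T X) :=
  epsilon (h X) (fun _ => True).

Section NuMonad.
Context (T : Monad C) (h : has_nu T).

Definition outr (X : C) : hom (nu h X) (T (X ⊕ nu h X)) := out (N := nu h X).
Definition outr_inv (X : C) : hom (T (X ⊕ nu h X)) (nu h X) := out_inv (N := nu h X).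
Definition coitr (X A : C) (a : hom A (T (X ⊕ A))) : hom A (nu h X) :=
  coit (N := nu h X) (a : hom A (res_functor T X A)).

Lemma outr_coitr (X A : C) (a : hom A (T (X ⊕ A))) :
  outr X \o coitr a = tmap T (cosum (idm X) (coitr a)) \o a.
Proof. exact (@out_coit C _ (nu h X) A a). Qed.

Lemma coitr_unique (X A : C) (a : hom A (T (X ⊕ A))) (k : hom A (nu h X)) :
  outr X \o k = tmap T (cosum (idm X) k) \o a -> k = coitr a.
Proof. exact (@coit_unique C _ (nu h X) A a k). Qed.

Lemma outr_inv_outr (X : C) : outr_inv X \o outr X = idm _.
Proof. apply (out_inv_out (nu h X)). Qed.

Lemma outr_outr_inv (X : C) : outr X \o outr_inv X = idm _.
Proof. apply (out_out_inv (nu h X)). Qed.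

Lemma outr_outr_inv_k (X Z : C) (k : hom Z _) : outr X \o (outr_inv X \o k) = k.
Proof. now rewrite <- comp_assoc, outr_outr_inv, comp_id_l. Qed.

Lemma outr_inv_outr_k (X Z : C) (k : hom Z _) : outr_inv X \o (outr X \o k) = k.
Proof. now rewrite <- comp_assoc, outr_inv_outr, comp_id_l. Qed.

Lemma outr_inj (X Z : C) (k l : hom Z (nu h X)) : outr X \o k = outr X \o l -> k = l.
Proof.
  intros E. now rewrite <- (outr_inv_outr_k k), E, outr_inv_outr_k.
Qed.

(* Solutions [k] of [out \o k = [p, eta \o inr \o k]^* \o g] exist uniquely; they are
   obtained by coiteration on [Z + T^nu Y], the second summand being run by [out]. *)
Definition corecr_coalg (X Y Z : C) (p : hom X (T (Y ⊕ nu h Y))) (g : hom Z (T (X ⊕ Z))) :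
    hom (Z ⊕ nu h Y) (T (Y ⊕ (Z ⊕ nu h Y))) :=
  [[ lift [[ tmap T (cosum (idm Y) inr) \o p, eta \o (inr \o inl) ]] \o g,
     tmap T (cosum (idm Y) inr) \o outr Y ]].

Definition corecr (X Y Z : C) (p : hom X (T (Y ⊕ nu h Y))) (g : hom Z (T (X ⊕ Z))) :
    hom Z (nu h Y) := coitr (corecr_coalg p g) \o inl.

Lemma coitr_outr (X : C) : coitr (outr X) = idm _.
Proof.
  symmetry. apply coitr_unique. rewrite cosum_id. cat.
  now rewrite lift_unit, comp_id_l.
Qed.

Lemma corecr_inr (X Y Z : C) (p : hom X (T (Y ⊕ nu h Y))) (g : hom Z (T (X ⊕ Z))) :
  coitr (corecr_coalg p g) \o inr = idm _.
Proof.
  rewrite <- coitr_outr. apply coitr_unique.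
  rewrite <- comp_assoc, outr_coitr. unfold corecr_coalg. cat. reflexivity.
Qed.

Lemma corecr_eq (X Y Z : C) (p : hom X (T (Y ⊕ nu h Y))) (g : hom Z (T (X ⊕ Z))) :
  outr Y \o corecr p g = lift [[ p, eta \o (inr \o corecr p g) ]] \o g.
Proof.
  unfold corecr. rewrite <- comp_assoc, outr_coitr.
  generalize (corecr_inr p g). generalize (coitr (corecr_coalg p g)). intros c E.
  unfold corecr_coalg. cat. rewrite E.
  f_equal. f_equal. f_equal.
  rewrite <- (comp_id_l p) at 2. f_equal.
  rewrite <- lift_unit. f_equal. cext.
Qed.

Lemma corecr_unique (X Y Z : C) (p : hom X (T (Y ⊕ nu h Y))) (g : hom Z (T (X ⊕ Z)))
    (k : hom Z (nu h Y)) :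
  outr Y \o k = lift [[ p, eta \o (inr \o k) ]] \o g -> k = corecr p g.
Proof.
  intros E. unfold corecr.
  assert (F : [[ k, idm (nu h Y) ]] = coitr (corecr_coalg p g)).
  { apply coitr_unique. unfold corecr_coalg.
    apply coprod_ext; cat.
    - rewrite E. f_equal. f_equal. f_equal.
      rewrite <- (comp_id_l p) at 1. f_equal.
      rewrite <- lift_unit. f_equal. cext.
    - rewrite <- (comp_id_l (outr Y)) at 1. f_equal.
      rewrite <- lift_unit. f_equal. cext. }
  rewrite <- F. cat. reflexivity.
Qed.

Definition nu_eta (X : C) : hom X (nu h X) := outr_inv X \o (eta \o inl).

Definition nu_lift (X Y : C) (f : hom X (nu h Y)) : hom (nu h X) (nu h Y) :=
  corecr (outr Y \o f) (outr X).

Lemma outr_nu_eta (X : C) : outr X \o nu_eta X = eta \o inl.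
Proof. apply outr_outr_inv_k. Qed.

Lemma outr_nu_eta_k (X Z : C) (k : hom Z X) : outr X \o (nu_eta X \o k) = eta \o (inl \o k).
Proof. now rewrite <- comp_assoc, outr_nu_eta, comp_assoc. Qed.

(* The equation determining the Kleisli lifting of [T^nu]. *)
Lemma outr_nu_lift (X Y : C) (f : hom X (nu h Y)) :
  outr Y \o nu_lift f = lift [[ outr Y \o f, eta \o (inr \o nu_lift f) ]] \o outr X.
Proof. apply corecr_eq. Qed.

Lemma nu_lift_unique (X Y : C) (f : hom X (nu h Y)) (k : hom (nu h X) (nu h Y)) :
  outr Y \o k = lift [[ outr Y \o f, eta \o (inr \o k) ]] \o outr X -> k = nu_lift f.
Proof. apply corecr_unique. Qed.

Lemma outr_nu_lift_k (X Y Z : C) (f : hom X (nu h Y)) (k : hom Z (nu h X)) :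
  outr Y \o (nu_lift f \o k)
    = lift [[ outr Y \o f, eta \o (inr \o nu_lift f) ]] \o (outr X \o k).
Proof. now rewrite <- comp_assoc, outr_nu_lift, comp_assoc. Qed.

Lemma nu_lift_unit (X : C) : nu_lift (nu_eta X) = idm (nu h X).
Proof.
  symmetry. apply nu_lift_unique. rewrite outr_nu_eta. cat.
  rewrite <- (comp_id_l (outr X)) at 1. f_equal.
  rewrite <- lift_unit. f_equal. cext.
Qed.

Lemma nu_lift_eta (X Y : C) (f : hom X (nu h Y)) : nu_lift f \o nu_eta X = f.
Proof.
  apply outr_inj. rewrite outr_nu_lift_k, outr_nu_eta. cat. reflexivity.
Qed.

Lemma nu_lift_lift (X Y Z : C) (g : hom Y (nu h Z)) (f : hom X (nu h Y)) :
  nu_lift g \o nu_lift f = nu_lift (nu_lift g \o f).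
Proof.
  apply nu_lift_unique. rewrite outr_nu_lift_k, outr_nu_lift. cat.
  now rewrite outr_nu_lift_k.
Qed.

Definition nu_monad : Monad C :=
  @MkMonad C (fun X => nu h X : C) nu_eta nu_lift nu_lift_unit nu_lift_eta nu_lift_lift.

(* [out], its inverse and coiteration, typed with [nu_monad]. *)
Definition outn (X : C) : hom (nu_monad X) (T (X ⊕ nu_monad X)) := outr X.
Definition outn_inv (X : C) : hom (T (X ⊕ nu_monad X)) (nu_monad X) := outr_inv X.
Definition coitn (X A : C) (a : hom A (T (X ⊕ A))) : hom A (nu_monad X) := coitr a.
Definition corec (X Y Z : C) (p : hom X (T (Y ⊕ nu_monad Y))) (g : hom Z (T (X ⊕ Z))) :
    hom Z (nu_monad Y) := corecr p g.

Lemma outn_coitn (X A : C) (a : hom A (T (X ⊕ A))) :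
  outn X \o coitn a = tmap T (cosum (idm X) (coitn a)) \o a.
Proof. exact (outr_coitr a). Qed.

Lemma coitn_unique (X A : C) (a : hom A (T (X ⊕ A))) (k : hom A (nu_monad X)) :
  outn X \o k = tmap T (cosum (idm X) k) \o a -> k = coitn a.
Proof. exact (@coitr_unique X A a k). Qed.

Lemma outn_inv_outn (X : C) : outn_inv X \o outn X = idm _.
Proof. exact (outr_inv_outr X). Qed.

Lemma outn_outn_inv (X : C) : outn X \o outn_inv X = idm _.
Proof. exact (outr_outr_inv X). Qed.

Lemma outn_outn_inv_k (X Z : C) (k : hom Z _) : outn X \o (outn_inv X \o k) = k.
Proof. exact (outr_outr_inv_k k). Qed.

Lemma outn_inj (X Z : C) (k l : hom Z (nu_monad X)) :
  outn X \o k = outn X \o l -> k = l.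
Proof. exact (@outr_inj X Z k l). Qed.

Lemma coitn_outn (X : C) : coitn (outn X) = idm _.
Proof. exact (coitr_outr X). Qed.

Lemma corec_unique (X Y Z : C) (p : hom X (T (Y ⊕ nu_monad Y))) (g : hom Z (T (X ⊕ Z)))
    (k : hom Z (nu_monad Y)) :
  outn Y \o k = lift [[ p, eta \o (inr \o k) ]] \o g -> k = corec p g.
Proof. exact (@corecr_unique X Y Z p g k). Qed.

Definition delay (X : C) : hom (nu_monad X) (nu_monad X) := outn_inv X \o (eta \o inr).

Lemma outn_lift (X Y : C) (f : hom X (nu_monad Y)) :
  outn Y \o lift f = lift [[ outn Y \o f, eta \o (inr \o lift f) ]] \o outn X.
Proof. exact (outr_nu_lift f). Qed.

Lemma outn_lift_k (X Y Z : C) (f : hom X (nu_monad Y)) (k : hom Z (nu_monad X)) :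
  outn Y \o (lift f \o k) = lift [[ outn Y \o f, eta \o (inr \o lift f) ]] \o (outn X \o k).
Proof. exact (outr_nu_lift_k f k). Qed.

Lemma outn_eta (X : C) : outn X \o @eta C nu_monad X = eta \o inl.
Proof. exact (outr_nu_eta X). Qed.

Lemma outn_eta_k (X Z : C) (k : hom Z X) :
  outn X \o (@eta C nu_monad X \o k) = eta \o (inl \o k).
Proof. exact (outr_nu_eta_k k). Qed.

Lemma outn_tmap (X Y : C) (f : hom X Y) :
  outn Y \o tmap nu_monad f = tmap T (cosum f (tmap nu_monad f)) \o outn X.
Proof. unfold tmap at 1. rewrite outn_lift, outn_eta_k. cat. reflexivity. Qed.

Lemma outn_tmap_k (X Y Z : C) (f : hom X Y) (k : hom Z (nu_monad X)) :
  outn Y \o (tmap nu_monad f \o k)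
    = tmap T (cosum f (tmap nu_monad f)) \o (outn X \o k).
Proof. now rewrite <- comp_assoc, outn_tmap, comp_assoc. Qed.

Definition bold_eta (X : C) : hom (T X) (nu_monad X) := outn_inv X \o tmap T inl.

Lemma bold_eta_eta (X : C) : bold_eta X \o eta = eta.
Proof.
  apply outn_inj. unfold bold_eta. rewrite comp_assoc, outn_outn_inv_k, outn_eta.
  cat. reflexivity.
Qed.

Lemma bold_eta_lift (X Y : C) (f : hom X (T Y)) :
  bold_eta Y \o lift f = lift (bold_eta Y \o f) \o bold_eta X.
Proof.
  apply outn_inj. rewrite outn_lift_k. unfold bold_eta.
  rewrite !comp_assoc, !outn_outn_inv_k. cat. reflexivity.
Qed.

Definition bold_eta_mm : MonadMorphism T nu_monad :=
  @MkMonadMorphism C T nu_monad bold_eta bold_eta_eta bold_eta_lift.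

End NuMonad.

Section NuMap.
Context (S T : Monad C) (hS : has_nu S) (hT : has_nu T) (a : MonadMorphism S T).

Definition nu_map (X : C) : hom (nu_monad hS X) (nu_monad hT X) :=
  coitn hT (a _ \o outn hS X).

Lemma outn_nu_map (X : C) :
  outn hT X \o nu_map X = tmap T (cosum (idm X) (nu_map X)) \o (a _ \o outn hS X).
Proof. apply outn_coitn. Qed.

Lemma outn_nu_map_k (X Z : C) (k : hom Z _) :
  outn hT X \o (nu_map X \o k)
    = tmap T (cosum (idm X) (nu_map X)) \o (a _ \o (outn hS X \o k)).
Proof. now rewrite <- comp_assoc, outn_nu_map, !comp_assoc. Qed.

Lemma nu_map_eta (X : C) : nu_map X \o eta = eta.
Proof.
  apply (outn_inj (h := hT)). rewrite outn_nu_map_k, !outn_eta. cat. reflexivity.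
Qed.

Lemma nu_map_lift (X Y : C) (f : hom X (nu_monad hS Y)) :
  nu_map Y \o lift f = lift (nu_map Y \o f) \o nu_map X.
Proof.
  transitivity (corec (outn hT Y \o (nu_map Y \o f)) (a _ \o outn hS X));
    [ | symmetry ]; apply corec_unique.
  - rewrite outn_nu_map_k, outn_lift. cat. now rewrite outn_nu_map_k; cat.
  - rewrite outn_lift_k, outn_nu_map. cat. reflexivity.
Qed.

Definition nu_map_mm : MonadMorphism (nu_monad hS) (nu_monad hT) :=
  @MkMonadMorphism C _ _ nu_map nu_map_eta nu_map_lift.

End NuMap.

Section NuMult.
Context (T : Monad C) (h : has_nu T) (hh : has_nu (nu_monad h)).

Definition bold_mu (X : C) : hom (nu_monad hh X) (nu_monad h X) :=
  coitn h (tmap T [[ idm _, inr \o outn_inv hh X ]] \o (outn h _ \o outn hh X)).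

Lemma outn_bold_mu (X : C) :
  outn h X \o bold_mu X
    = tmap T (cosum (idm X) (bold_mu X))
        \o (tmap T [[ idm _, inr \o outn_inv hh X ]] \o (outn h _ \o outn hh X)).
Proof. apply outn_coitn. Qed.

Lemma outn_bold_mu_k (X Z : C) (k : hom Z _) :
  outn h X \o (bold_mu X \o k)
    = tmap T (cosum (idm X) (bold_mu X))
        \o (tmap T [[ idm _, inr \o outn_inv hh X ]] \o (outn h _ \o (outn hh X \o k))).
Proof. now rewrite <- comp_assoc, outn_bold_mu, !comp_assoc. Qed.

Lemma bold_mu_eta (X : C) : bold_mu X \o eta = eta.
Proof.
  apply (outn_inj (h := h)).
  rewrite outn_bold_mu_k, outn_eta, outn_eta_k, outn_eta. cat. reflexivity.
Qed.

Lemma bold_mu_lift (X Y : C) (f : hom X (nu_monad hh Y)) :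
  bold_mu Y \o lift f = lift (bold_mu Y \o f) \o bold_mu X.
Proof.
  transitivity (corec (outn h Y \o (bold_mu Y \o f))
    (tmap T [[ idm _, inr \o outn_inv hh X ]] \o (outn h _ \o outn hh X)));
    [ | symmetry ]; apply corec_unique.
  - assert (E : lift f \o outn_inv hh X
        = outn_inv hh Y \o lift [[ outn hh Y \o f, eta \o (inr \o lift f) ]]).
    { apply (outn_inj (h := hh)).
      rewrite outn_lift_k, outn_outn_inv, outn_outn_inv_k. apply comp_id_r. }
    rewrite !outn_bold_mu_k, outn_lift, outn_lift_k. cat.
    rewrite outn_eta_k. cat. rewrite E. reflexivity.
  - rewrite outn_lift_k, outn_bold_mu. cat. reflexivity.
Qed.

Definition bold_mu_mm : MonadMorphism (nu_monad hh) (nu_monad h) :=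
  @MkMonadMorphism C _ _ bold_mu bold_mu_eta bold_mu_lift.

End NuMult.

Local Ltac mms :=
  cbn [mm mm_id mm_comp nu_map_mm bold_eta_mm bold_mu_mm].

Lemma nu_map_id (T : Monad C) (h : has_nu T) : nu_map_mm h h (mm_id T) = mm_id _.
Proof.
  apply monad_morphism_ext; intros X; mms. unfold nu_map; mms.
  rewrite comp_id_l. apply coitn_outn.
Qed.

Lemma nu_map_comp (R S T : Monad C) (hR : has_nu R) (hS : has_nu S) (hT : has_nu T)
    (b : MonadMorphism S T) (a : MonadMorphism R S) :
  nu_map_mm hR hT (mm_comp b a) = mm_comp (nu_map_mm hS hT b) (nu_map_mm hR hS a).
Proof.
  apply monad_morphism_ext; intros X; mms. symmetry. apply coitn_unique; mms.
  rewrite outn_nu_map_k, outn_nu_map. cat. reflexivity.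
Qed.

Lemma bold_eta_nat (S T : Monad C) (hS : has_nu S) (hT : has_nu T)
    (a : MonadMorphism S T) :
  mm_comp (nu_map_mm hS hT a) (bold_eta_mm hS) = mm_comp (bold_eta_mm hT) a.
Proof.
  apply monad_morphism_ext; intros X; mms.
  apply (outn_inj (h := hT)). rewrite outn_nu_map_k. unfold bold_eta.
  rewrite !comp_assoc, !outn_outn_inv_k. cat. reflexivity.
Qed.

Lemma nu_map_outn_inv (S T : Monad C) (hS : has_nu S) (hT : has_nu T)
    (a : MonadMorphism S T) (X : C) :
  nu_map hS hT a X \o outn_inv hS X
    = outn_inv hT X \o (tmap T (cosum (idm X) (nu_map hS hT a X)) \o a _).
Proof.
  apply (outn_inj (h := hT)).
  now rewrite outn_nu_map_k, outn_outn_inv, outn_outn_inv_k, comp_id_r.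
Qed.

Lemma bold_mu_nat (S T : Monad C) (hS : has_nu S) (hT : has_nu T)
    (hhS : has_nu (nu_monad hS)) (hhT : has_nu (nu_monad hT)) (a : MonadMorphism S T) :
  mm_comp (nu_map_mm hS hT a) (bold_mu_mm hhS)
    = mm_comp (bold_mu_mm hhT) (nu_map_mm hhS hhT (nu_map_mm hS hT a)).
Proof.
  apply monad_morphism_ext; intros X; mms.
  transitivity (coitn hT
    (tmap T [[ idm _, inr \o outn_inv hhS X ]] \o (a _ \o (outn hS _ \o outn hhS X))));
    [ | symmetry ]; apply coitn_unique.
  - rewrite outn_nu_map_k, outn_bold_mu. cat. reflexivity.
  - rewrite outn_bold_mu_k, outn_nu_map, outn_tmap_k; mms. rewrite outn_nu_map_k. cat.
    f_equal. f_equal. apply coprod_ext; cat; [reflexivity|].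
    f_equal. f_equal. f_equal. rewrite nu_map_outn_inv. unfold tmap, cosum; mms.
    cat. reflexivity.
Qed.

Lemma bold_mu_unit_l (T : Monad C) (h : has_nu T) (hh : has_nu (nu_monad h)) :
  mm_comp (bold_mu_mm hh) (bold_eta_mm hh) = mm_id (nu_monad h).
Proof.
  apply monad_morphism_ext; intros X; mms.
  rewrite <- coitn_outn. apply coitn_unique.
  rewrite outn_bold_mu_k. unfold bold_eta at 1.
  rewrite outn_outn_inv_k, outn_tmap. cat. reflexivity.
Qed.

Lemma bold_mu_unit_r (T : Monad C) (h : has_nu T) (hh : has_nu (nu_monad h)) :
  mm_comp (bold_mu_mm hh) (nu_map_mm h hh (bold_eta_mm h)) = mm_id (nu_monad h).
Proof.
  apply monad_morphism_ext; intros X; mms.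
  rewrite <- coitn_outn. apply coitn_unique.
  rewrite outn_bold_mu_k, outn_nu_map, outn_tmap_k; mms.
  unfold bold_eta. rewrite comp_assoc, outn_outn_inv_k. cat. reflexivity.
Qed.

Lemma bold_mu_assoc (T : Monad C) (h : has_nu T) (hh : has_nu (nu_monad h))
    (hhh : has_nu (nu_monad hh)) :
  mm_comp (bold_mu_mm hh) (bold_mu_mm hhh)
    = mm_comp (bold_mu_mm hh) (nu_map_mm hhh hh (bold_mu_mm hh)).
Proof.
  apply monad_morphism_ext; intros X; mms.
  transitivity (coitn h
    (tmap T [[ [[ idm _, inr \o outn_inv hhh X ]],
               inr \o (outn_inv hhh X \o outn_inv hh _) ]]
      \o (outn h _ \o (outn hh _ \o outn hhh X))));
    [ | symmetry ]; apply coitn_unique.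
  - assert (E : outn_inv hh X \o tmap (nu_monad h)
        (cosum (idm X) (bold_mu hhh X) \o [[ idm _, inr \o outn_inv hhh X ]])
        = bold_mu hhh X \o (outn_inv hhh X \o outn_inv hh _)).
    { apply (outn_inj (h := hh)).
      rewrite outn_outn_inv_k, outn_bold_mu_k, outn_outn_inv_k, outn_outn_inv.
      cat. reflexivity. }
    rewrite outn_bold_mu_k, outn_bold_mu, !outn_tmap_k.
    cat. f_equal. f_equal. repeat apply coprod_ext; cat; try reflexivity.
    rewrite <- E. cat. reflexivity.
  - rewrite outn_bold_mu_k, outn_nu_map, outn_tmap_k; mms. rewrite outn_bold_mu_k. cat.
    f_equal. f_equal. repeat apply coprod_ext; cat; try reflexivity.
    all: f_equal; f_equal; f_equal.
    all: try rewrite <- (comp_assoc (nu_map hhh hh (bold_mu_mm hh) X)).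
    all: rewrite nu_map_outn_inv; mms; cat; reflexivity.
Qed.

(* The level 0 is vacuous, so that level 1 says exactly that [T^nu] exists. *)
Fixpoint iteratable (n : nat) (T : Monad C) : Prop :=
  match n with
  | O => True
  | Datatypes.S n => exists h : has_nu T, iteratable n (nu_monad h)
  end.

Definition omega_iteratable (T : Monad C) : Prop := forall n, iteratable n T.

Lemma omega_has_nu (T : Monad C) : omega_iteratable T -> has_nu T.
Proof. intros w. destruct (w 1) as [h _]. exact h. Qed.

Lemma omega_nu (T : Monad C) (w : omega_iteratable T) :
  omega_iteratable (nu_monad (omega_has_nu w)).
Proof.
  intros n. destruct (w (Datatypes.S n)) as [h it].
  now rewrite (proof_irrelevance _ (omega_has_nu w) h).
Qed.

Definition omega_monads : Category :=
  @full_subcategory (monad_category C) omega_iteratable.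

Definition has_nu_of (T : omega_monads) : has_nu (proj1_sig T) :=
  omega_has_nu (proj2_sig T).

Definition nu_ob (T : omega_monads) : omega_monads :=
  exist _ (nu_monad (has_nu_of T)) (omega_nu (proj2_sig T)).

Definition nu_functor : Functor omega_monads omega_monads :=
  @MkFunctor omega_monads omega_monads nu_ob
    (fun S T a => nu_map_mm (has_nu_of S) (has_nu_of T) a)
    (fun T => nu_map_id (has_nu_of T))
    (fun R S T b a => nu_map_comp (has_nu_of R) (has_nu_of S) (has_nu_of T) b a).

Definition nu_triple : TripleMonad omega_monads :=
  @MkTripleMonad omega_monads nu_functor
    (fun T => bold_eta_mm (has_nu_of T))
    (fun T => bold_mu_mm (has_nu_of (nu_ob T)))
    (fun S T a => bold_eta_nat (has_nu_of S) (has_nu_of T) a)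
    (fun S T a => bold_mu_nat (has_nu_of (nu_ob S)) (has_nu_of (nu_ob T)) a)
    (fun T => bold_mu_unit_l (has_nu_of (nu_ob T)))
    (fun T => bold_mu_unit_r (has_nu_of (nu_ob T)))
    (fun T => @bold_mu_assoc _ (has_nu_of T) (has_nu_of (nu_ob T))
                (has_nu_of (nu_ob (nu_ob T)))).


Definition delay_cancellation (a : EM_category nu_triple) : Prop :=
  let rho : MonadMorphism (nu_monad (has_nu_of (alg_carrier a)))
                          (proj1_sig (alg_carrier a)) := alg_map a in
  forall X : C, rho X \o delay (has_nu_of (alg_carrier a)) X = rho X.

Record ElgotOperator (S : Monad C) := MkElgotOperator {
  dagger :> forall X Y : C, hom X (S (Y ⊕ X)) -> hom X (S Y);
  dagger_fixpoint : forall (X Y : C) (f : hom X (S (Y ⊕ X))),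
    dagger f = lift [[ eta, dagger f ]] \o f;
  dagger_naturality : forall (X Y Z : C) (f : hom X (S (Y ⊕ X))) (g : hom Y (S Z)),
    lift g \o dagger f = dagger (lift [[ tmap S inl \o g, eta \o inr ]] \o f);
  dagger_codiagonal : forall (X Y : C) (f : hom X (S ((Y ⊕ X) ⊕ X))),
    dagger (tmap S [[ idm (Y ⊕ X), inr ]] \o f) = dagger (dagger f);
  dagger_uniformity : forall (X Y Z : C) (f : hom X (S (Y ⊕ X)))
      (g : hom Z (S (Y ⊕ Z))) (k : hom Z X),
    f \o k = tmap S (cosum (idm Y) k) \o g -> dagger f \o k = dagger g
}.

Arguments dagger {S} _ {X Y} _ : rename.

Record OmegaElgotMonad := MkOmegaElgotMonad {
  elgot_monad : omega_monads;
  elgot_operator : ElgotOperator (proj1_sig elgot_monad)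
}.

Definition preserves_iteration (A B : OmegaElgotMonad)
    (a : MonadMorphism (proj1_sig (elgot_monad A)) (proj1_sig (elgot_monad B))) : Prop :=
  forall (X Y : C) (f : hom X (proj1_sig (elgot_monad A) (Y ⊕ X))),
    a Y \o dagger (elgot_operator A) f = dagger (elgot_operator B) (a (Y ⊕ X) \o f).

Definition elgot_hom (A B : OmegaElgotMonad) : Type :=
  {a : MonadMorphism (proj1_sig (elgot_monad A)) (proj1_sig (elgot_monad B))
     | preserves_iteration a}.

Lemma elgot_id_preserves (A : OmegaElgotMonad) :
  @preserves_iteration A A (mm_id (proj1_sig (elgot_monad A))).
Proof. intros X Y f; simpl. now rewrite !comp_id_l. Qed.

Lemma elgot_comp_preserves (A B D : OmegaElgotMonad)
    (b : elgot_hom B D) (a : elgot_hom A B) :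
  @preserves_iteration A D (mm_comp (proj1_sig b) (proj1_sig a)).
Proof.
  destruct a as [a Ha], b as [b Hb]. intros X Y f; simpl.
  now rewrite !comp_assoc, Ha, Hb.
Qed.

Definition elgot_id (A : OmegaElgotMonad) : elgot_hom A A :=
  exist _ (mm_id _) (@elgot_id_preserves A).

Definition elgot_comp (A B D : OmegaElgotMonad)
    (b : elgot_hom B D) (a : elgot_hom A B) : elgot_hom A D :=
  exist _ (mm_comp (proj1_sig b) (proj1_sig a)) (elgot_comp_preserves b a).

Lemma elgot_comp_id_l (A B : OmegaElgotMonad) (a : elgot_hom A B) :
  elgot_comp (elgot_id B) a = a.
Proof. apply sig_ext, mm_comp_id_l. Qed.

Lemma elgot_comp_id_r (A B : OmegaElgotMonad) (a : elgot_hom A B) :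
  elgot_comp a (elgot_id A) = a.
Proof. apply sig_ext, mm_comp_id_r. Qed.

Lemma elgot_comp_assoc (A B D E : OmegaElgotMonad)
    (c : elgot_hom D E) (b : elgot_hom B D) (a : elgot_hom A B) :
  elgot_comp (elgot_comp c b) a = elgot_comp c (elgot_comp b a).
Proof. apply sig_ext, mm_comp_assoc. Qed.

Definition omega_elgot_monads : Category :=
  @MkCategory OmegaElgotMonad elgot_hom elgot_id elgot_comp
    elgot_comp_id_l elgot_comp_id_r elgot_comp_assoc.

End Nu.

(* Main.v *)
From Stdlib Require Import FunctionalExtensionality ProofIrrelevance.
Require Import Defs.

(* An Elgot monad [S] becomes an algebra through [rho := out^dagger]; conversely an algebra
   iterates [f] by [f^dagger := rho \o coit f].  Uniformity applied to coalgebra morphisms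
   gives [out^dagger \o coit f = f^dagger], and [coit out = id], so the two passages are
   mutually inverse.  Codiagonal corresponds to the multiplication law of [rho], and the
   fixpoint law to [rho \o out^-1 = [eta, rho]^*], which is where delay cancellation
   enters, since [out^-1 = [eta, delay]^* \o bold_eta]. *)

Set Implicit Arguments.
Unset Strict Implicit.
Unset Printing Implicit Defensive.

(** * Equality of functors and preliminary identities *)

Definition arrow (A : Category) (X Y : A) (f : hom X Y) :
    {XY : A * A & hom (fst XY) (snd XY)} :=
  existT (fun XY : A * A => hom (fst XY) (snd XY)) (X, Y) f.

(* Packing morphisms with their endpoints lets functors that agree on objects only
   propositionally be compared without transports. *)
Lemma functor_ext (A B : Category) (F G : Functor A B) :
  (forall (X Y : A) (f : hom X Y), arrow (fmap F f) = arrow (fmap G f)) -> F = G.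
Proof.
  destruct F as [Fo Fm F1 F2], G as [Go Gm G1 G2]; simpl; intros E.
  assert (Fo = Go) as <-.
  { apply functional_extensionality; intros X.
    (* Equal packed images of an identity have equal sources. *)
    exact (f_equal (fun p => fst (projT1 p)) (E X X (idm X))). }
  assert (Fm = Gm) as <-.
  { apply functional_extensionality_dep; intros X.
    apply functional_extensionality_dep; intros Y.
    apply functional_extensionality; intros f.
    exact (inj_pair2 _ _ _ _ _ (E X Y f)). }
  f_equal; apply proof_irrelevance.
Qed.

Ltac cat_simpl :=
  unfold tmap, cosum;
  repeat first
    [ rewrite comp_assoc | rewrite comp_id_l | rewrite comp_id_r
    | rewrite comp_copair
    | rewrite copair_inl | rewrite copair_inr
    | rewrite copair_inl_k | rewrite copair_inr_k
    | rewrite mm_eta | rewrite mm_eta_k | rewrite mm_lift | rewrite mm_lift_k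
    | rewrite lift_eta | rewrite lift_eta_k
    | rewrite lift_lift | rewrite lift_lift_k ].

Section ElgotAlgebras.
Context (C : Category) (H : FiniteCoproducts C).

Local Notation "X ⊕ Y" := (@coprod C H X Y)
  (at level 50, left associativity) : cat_scope.

Lemma copair_inl_inr (X Y : C) : [[ inl, inr ]] = idm (X ⊕ Y).
Proof. apply coprod_ext; cat_simpl; reflexivity. Qed.

Lemma lift_eta_inl_inr (T : Monad C) (X Y : C) :
  lift [[ eta \o inl, eta \o inr ]] = idm (T (X ⊕ Y)).
Proof. now rewrite <- comp_copair, copair_inl_inr, comp_id_r, lift_unit. Qed.

(** By finality: the composite is a coalgebra morphism out of [a \o f]. *)
Lemma nu_map_coitn (S T : Monad C) (hS : has_nu H S) (hT : has_nu H T)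
    (a : MonadMorphism S T) (X Y : C) (f : hom X (S (Y ⊕ X))) :
  nu_map hS hT a Y \o coitn hS f = coitn hT (a (Y ⊕ X) \o f).
Proof.
  apply coitn_unique. rewrite outn_nu_map_k, outn_coitn. cat_simpl. reflexivity.
Qed.

(** * From an Elgot operator to an algebra *)

Section FromElgot.
Context (S : Monad C) (h : has_nu H S) (D : ElgotOperator H S).

Definition iter_out (X : C) : hom (nu_monad h X) (S X) := dagger D (outn h X).

Lemma iter_out_coalg (X A : C) (a : hom A (S (X ⊕ A))) (k : hom A (nu_monad h X)) :
  outn h X \o k = tmap S (cosum H (idm X) k) \o a -> iter_out X \o k = dagger D a.
Proof. apply dagger_uniformity. Qed.

Lemma iter_out_coitn (X A : C) (a : hom A (S (X ⊕ A))) :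
  iter_out X \o coitn h a = dagger D a.
Proof. apply iter_out_coalg, outn_coitn. Qed.

Lemma iter_out_unfold (X : C) :
  iter_out X = lift [[ eta, iter_out X ]] \o outn h X.
Proof. apply dagger_fixpoint. Qed.

Lemma iter_out_outn_inv (X : C) :
  iter_out X \o outn_inv h X = lift [[ eta, iter_out X ]].
Proof. now rewrite iter_out_unfold at 1; rewrite comp_assoc, outn_outn_inv, comp_id_r. Qed.

Lemma iter_out_eta (X : C) : iter_out X \o eta = eta.
Proof.
  rewrite iter_out_unfold, comp_assoc, outn_eta. cat_simpl. reflexivity.
Qed.

(* The copairing [[ f^‡, id ]] is a coalgebra morphism out of the coalgebra that runs
   [S^nu X] until it returns and then continues as [f].  Splitting the loop of this
   coalgebra into an inner one for the first phase and an outer one for the second,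
   codiagonal turns it into the composite of the two iterations. *)
Lemma iter_out_lift (X Y : C) (f : hom X (nu_monad h Y)) :
  iter_out Y \o lift f = lift (iter_out Y \o f) \o iter_out X.
Proof.
  set (g := tmap S (cosum H (idm Y) inr) \o (outn h Y \o f)
            : hom X (S (Y ⊕ (nu_monad h X ⊕ nu_monad h Y)))).
  set (r := tmap S (cosum H (idm Y) inr) \o outn h Y
            : hom (nu_monad h Y) (S (Y ⊕ (nu_monad h X ⊕ nu_monad h Y)))).
  set (d := [[ lift [[ tmap S inl \o g, eta \o (inr \o inl) ]] \o outn h X,
               tmap S inl \o r ]]
            : hom (nu_monad h X ⊕ nu_monad h Y)
                (S ((Y ⊕ (nu_monad h X ⊕ nu_monad h Y)) ⊕ (nu_monad h X ⊕ nu_monad h Y)))).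
  (* On the right summand [d] leaves the inner loop at once, so one unfolding suffices. *)
  assert (Er : dagger D d \o inr = r).
  { rewrite dagger_fixpoint. unfold d at 2. cat_simpl.
    now rewrite lift_unit, comp_id_l. }
  (* Once naturality has absorbed [g] into the loop, [inl] is a coalgebra morphism into [d]. *)
  assert (El : dagger D d \o inl = lift g \o iter_out X).
  { unfold iter_out. rewrite dagger_naturality. apply dagger_uniformity.
    unfold d. cat_simpl. reflexivity. }
  assert (Er2 : dagger D (dagger D d) \o inr = iter_out Y).
  { apply dagger_uniformity. exact Er. }
  assert (El2 : dagger D (dagger D d) \o inl = lift (iter_out Y \o f) \o iter_out X).
  { rewrite dagger_fixpoint, comp_assoc, El. unfold g. cat_simpl.
    rewrite Er2. rewrite (iter_out_unfold Y) at 2. cat_simpl. reflexivity. }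
  rewrite <- El2, <- dagger_codiagonal.
  rewrite <- (iter_out_coalg (k := [[ lift f, idm (nu_monad h Y) ]])).
  - now rewrite comp_assoc, copair_inl.
  - apply coprod_ext; unfold d, g, r; cat_simpl.
    + rewrite outn_lift. rewrite lift_eta_inl_inr, comp_id_l. reflexivity.
    + rewrite lift_eta_inl_inr, comp_id_l. reflexivity.
Qed.

Definition iter_out_mm : MonadMorphism (nu_monad h) S :=
  @MkMonadMorphism C (nu_monad h) S iter_out iter_out_eta iter_out_lift.

Lemma iter_out_bold_eta (X : C) : iter_out X \o bold_eta h X = idm (S X).
Proof.
  unfold bold_eta. rewrite <- comp_assoc, iter_out_outn_inv. cat_simpl.
  apply lift_unit.
Qed.

(** The delay selects the second branch of [[[ eta, iter_out X ]]], so the fixpoint law yields the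
    cancellation. *)
Lemma iter_out_delay (X : C) : iter_out X \o delay h X = iter_out X.
Proof.
  unfold delay. rewrite <- comp_assoc, iter_out_outn_inv. cat_simpl. reflexivity.
Qed.

(** Both sides are iterates of coalgebras on the double [nu]; they are the two sides of codiagonal
    for [d], which unfolds both layers and rolls the inner state back up. *)
Lemma iter_out_bold_mu (hh : has_nu H (nu_monad h)) (X : C) :
  iter_out X \o bold_mu hh X = iter_out X \o nu_map hh h iter_out_mm X.
Proof.
  unfold bold_mu, nu_map. rewrite !iter_out_coitn. cbn [mm iter_out_mm].
  set (d := tmap S (cosum H (idm (X ⊕ nu_monad hh X)) (outn_inv hh X))
              \o (outn h _ \o outn hh X)).
  (* Uniformity along [outn_inv] transports the inner loop from [outn h _] to [d]. *)
  assert (Ed : dagger D d = iter_out _ \o outn hh X).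
  { rewrite <- (comp_id_r (dagger D d)), <- (outn_inv_outn hh X), <- comp_assoc.
    f_equal. apply dagger_uniformity. unfold d.
    now rewrite !comp_assoc, outn_outn_inv, comp_id_r. }
  rewrite <- Ed, <- dagger_codiagonal. f_equal. unfold d. cat_simpl. reflexivity.
Qed.

End FromElgot.

(** * From a delay-cancelling algebra to an Elgot operator *)

Section FromAlgebra.
Context (S : Monad C) (h : has_nu H S) (hh : has_nu H (nu_monad h)).
Context (rho : MonadMorphism (nu_monad h) S).
Context (rho_unit : forall X, rho X \o bold_eta h X = idm (S X)).
Context (rho_mult : forall X, rho X \o bold_mu hh X = rho X \o nu_map hh h rho X).
Context (rho_delay : forall X, rho X \o delay h X = rho X).

Definition run_coit (X Y : C) (f : hom X (S (Y ⊕ X))) : hom X (S Y) :=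
  rho Y \o coitn h f.

(** A layer of [S] is embedded by [bold_eta], and its continuing states resume after a delay; the
    monad morphism [rho] can be pushed through this form. *)
Lemma outn_inv_bold_eta (X : C) :
  outn_inv h X = lift [[ eta, delay h X ]] \o bold_eta h (X ⊕ nu_monad h X).
Proof.
  apply (outn_inj (h := h)). rewrite outn_lift_k. unfold bold_eta, delay.
  rewrite !outn_outn_inv, outn_outn_inv_k, comp_copair, outn_eta, outn_outn_inv_k.
  cat_simpl. now rewrite lift_eta_inl_inr.
Qed.

Lemma rho_outn_inv (X : C) : rho X \o outn_inv h X = lift [[ eta, rho X ]].
Proof.
  rewrite outn_inv_bold_eta, mm_lift_k, rho_unit, comp_id_r, comp_copair, mm_eta.
  now rewrite rho_delay.
Qed.

Lemma run_coit_fixpoint (X Y : C) (f : hom X (S (Y ⊕ X))) :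
  run_coit f = lift [[ eta, run_coit f ]] \o f.
Proof.
  unfold run_coit at 1.
  rewrite <- (comp_id_l (coitn h f)), <- (outn_inv_outn h Y), comp_assoc, outn_coitn.
  rewrite <- comp_assoc, rho_outn_inv. cat_simpl. reflexivity.
Qed.

Lemma run_coit_naturality (X Y Z : C) (f : hom X (S (Y ⊕ X))) (g : hom Y (S Z)) :
  lift g \o run_coit f = run_coit (lift [[ tmap S inl \o g, eta \o inr ]] \o f).
Proof.
  unfold run_coit.
  (* The unit law writes [g] as [rho \o bold_eta \o g], so the lifting moves inside [rho]. *)
  rewrite <- (comp_id_l g) at 1. rewrite <- rho_unit, comp_assoc, <- mm_lift_k.
  f_equal. apply coitn_unique.
  rewrite outn_lift_k, outn_coitn. unfold bold_eta.
  rewrite comp_assoc, outn_outn_inv_k. cat_simpl. reflexivity.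
Qed.

(** Already [coitn h f \o k] is a coalgebra morphism out of [g]. *)
Lemma run_coit_uniformity (X Y Z : C) (f : hom X (S (Y ⊕ X)))
    (g : hom Z (S (Y ⊕ Z))) (k : hom Z X) :
  f \o k = tmap S (cosum H (idm Y) k) \o g -> run_coit f \o k = run_coit g.
Proof.
  intros E. unfold run_coit. rewrite comp_assoc. f_equal. apply coitn_unique.
  rewrite <- comp_assoc, outn_coitn, comp_assoc, E. cat_simpl. reflexivity.
Qed.

Lemma bold_mu_coitn_coitn (X Y : C) (f : hom X (S ((Y ⊕ X) ⊕ X))) :
  bold_mu hh Y \o coitn hh (coitn h f) = coitn h (tmap S [[ idm (Y ⊕ X), inr ]] \o f).
Proof.
  apply coitn_unique.
  set (k := coitn hh (coitn h f)).
  (* Rolls one unfolding of [k] back up, matching the [outn_inv] inside [bold_mu]. *)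
  assert (E : outn_inv hh Y \o (tmap (nu_monad h) (cosum H (idm Y) k) \o coitn h f) = k).
  { unfold k. rewrite <- outn_coitn, <- comp_assoc, outn_inv_outn. apply comp_id_l. }
  rewrite outn_bold_mu_k. unfold k at 1. rewrite outn_coitn. fold k.
  rewrite outn_tmap_k, outn_coitn.
  revert E. cat_simpl. intros E. now rewrite E.
Qed.

(** Both sides are images of [coitn hh (coitn h f)], under [rho \o bold_mu] and under [rho] after
    [nu_map] of [rho]; the multiplication law equates these. *)
Lemma run_coit_codiagonal (X Y : C) (f : hom X (S ((Y ⊕ X) ⊕ X))) :
  run_coit (tmap S [[ idm (Y ⊕ X), inr ]] \o f) = run_coit (run_coit f).
Proof.
  unfold run_coit.
  rewrite <- nu_map_coitn with (hS := hh).
  now rewrite <- bold_mu_coitn_coitn, <- !comp_assoc, rho_mult.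
Qed.

Definition run_coit_elgot : ElgotOperator H S :=
  MkElgotOperator run_coit_fixpoint run_coit_naturality run_coit_codiagonal
    run_coit_uniformity.

End FromAlgebra.

(** * The functors between Elgot monads and algebras *)

Section Functors.

Local Notation Elgot := (omega_elgot_monads H).
Local Notation Alg := (EM_category (nu_triple H)).
Local Notation DelayAlg := (@full_subcategory Alg (@delay_cancellation C H)).

Section ElgotToAlgebra.
Context (A : OmegaElgotMonad H).

Definition elgot_alg_map : MonadMorphism (nu_monad (has_nu_of (elgot_monad A)))
    (proj1_sig (elgot_monad A)) :=
  iter_out_mm (has_nu_of (elgot_monad A)) (elgot_operator A).

Lemma elgot_alg_unit :
  mm_comp elgot_alg_map (bold_eta_mm (has_nu_of (elgot_monad A)))
    = mm_id (proj1_sig (elgot_monad A)).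
Proof. apply monad_morphism_ext, iter_out_bold_eta. Qed.

Lemma elgot_alg_mult :
  mm_comp elgot_alg_map (bold_mu_mm (has_nu_of (nu_ob (elgot_monad A))))
    = mm_comp elgot_alg_map
        (nu_map_mm (has_nu_of (nu_ob (elgot_monad A))) (has_nu_of (elgot_monad A))
          elgot_alg_map).
Proof. apply monad_morphism_ext, iter_out_bold_mu. Qed.

Definition elgot_alg : EMAlgebra (nu_triple H) :=
  @MkEMAlgebra (omega_monads H) (nu_triple H) (elgot_monad A)
    elgot_alg_map elgot_alg_unit elgot_alg_mult.

Lemma elgot_alg_delay : @delay_cancellation C H elgot_alg.
Proof. intros X. apply iter_out_delay. Qed.

Definition elgot_delay_alg : DelayAlg := exist _ elgot_alg elgot_alg_delay.

End ElgotToAlgebra.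

(** The algebra square is preservation of the iterate of [outn], since [nu_map] is the coiteration
    of [a \o outn]. *)
Lemma preserves_iteration_alg (A B : OmegaElgotMonad H) (a : elgot_hom A B) :
  @is_alg_morphism _ (nu_triple H) (elgot_alg A) (elgot_alg B) (proj1_sig a).
Proof.
  destruct a as [a Ha]. apply monad_morphism_ext. intros X.
  change (a X \o dagger (elgot_operator A) (outn (has_nu_of (elgot_monad A)) X)
    = iter_out (has_nu_of (elgot_monad B)) (elgot_operator B) X
        \o nu_map (has_nu_of (elgot_monad A)) (has_nu_of (elgot_monad B)) a X).
  unfold nu_map. now rewrite Ha, iter_out_coitn.
Qed.

Definition elgot_to_alg_map (A B : Elgot) (a : hom A B) :
    hom (elgot_delay_alg A) (elgot_delay_alg B) :=
  exist _ (proj1_sig a) (preserves_iteration_alg a).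

Lemma elgot_to_alg_map_id (A : Elgot) : elgot_to_alg_map (idm A) = idm _.
Proof. now apply sig_ext. Qed.

Lemma elgot_to_alg_map_comp (A B D : Elgot) (b : hom B D) (a : hom A B) :
  elgot_to_alg_map (b \o a) = elgot_to_alg_map b \o elgot_to_alg_map a.
Proof. now apply sig_ext. Qed.

Definition elgot_to_alg : Functor Elgot DelayAlg :=
  @MkFunctor Elgot DelayAlg elgot_delay_alg elgot_to_alg_map
    elgot_to_alg_map_id elgot_to_alg_map_comp.

Section AlgebraToElgot.
Context (a : DelayAlg).

Definition alg_monad : Monad C := proj1_sig (alg_carrier (proj1_sig a)).
Definition alg_has_nu : has_nu H alg_monad := has_nu_of (alg_carrier (proj1_sig a)).
Definition alg_rho : MonadMorphism (nu_monad alg_has_nu) alg_monad :=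
  alg_map (proj1_sig a).

Lemma alg_rho_unit (X : C) : alg_rho X \o bold_eta alg_has_nu X = idm (alg_monad X).
Proof.
  exact (f_equal (fun m : MonadMorphism alg_monad alg_monad => m X)
           (alg_unit (proj1_sig a))).
Qed.

Lemma alg_rho_mult (X : C) :
  alg_rho X \o bold_mu (has_nu_of (nu_ob (alg_carrier (proj1_sig a)))) X
    = alg_rho X \o nu_map (has_nu_of (nu_ob (alg_carrier (proj1_sig a)))) alg_has_nu
                     alg_rho X.
Proof.
  exact (f_equal
    (fun m : MonadMorphism
       (nu_monad (has_nu_of (nu_ob (alg_carrier (proj1_sig a))))) alg_monad => m X)
    (alg_mult (proj1_sig a))).
Qed.

Definition alg_elgot : OmegaElgotMonad H :=
  MkOmegaElgotMonad (elgot_monad := alg_carrier (proj1_sig a))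
    (run_coit_elgot alg_rho_unit alg_rho_mult (proj2_sig a)).

End AlgebraToElgot.

(** Precompose the algebra square with the coiteration of [g] and apply [nu_map_coitn]. *)
Lemma alg_morphism_preserves_iteration (a b : DelayAlg) (f : hom a b) :
  @preserves_iteration C H (alg_elgot a) (alg_elgot b) (proj1_sig f).
Proof.
  intros X Y g. destruct f as [f Hf]. cbn [proj1_sig].
  change (MonadMorphism (alg_monad a) (alg_monad b)) in f.
  assert (E : f Y \o alg_rho a Y
    = alg_rho b Y \o nu_map (alg_has_nu a) (alg_has_nu b) f Y).
  { exact (f_equal (fun m : MonadMorphism (nu_monad (alg_has_nu a)) (alg_monad b) => m Y)
             Hf). }
  change (f Y \o (alg_rho a Y \o coitn (alg_has_nu a) g)
    = alg_rho b Y \o coitn (alg_has_nu b) (f (Y ⊕ X) \o g)).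
  now rewrite <- comp_assoc, E, comp_assoc, nu_map_coitn.
Qed.

Definition alg_to_elgot_map (a b : DelayAlg) (f : hom a b) :
    elgot_hom (alg_elgot a) (alg_elgot b) :=
  exist _ (proj1_sig f) (alg_morphism_preserves_iteration f).

Lemma alg_to_elgot_map_id (a : DelayAlg) : alg_to_elgot_map (idm a) = elgot_id _.
Proof. now apply sig_ext. Qed.

Lemma alg_to_elgot_map_comp (a b c : DelayAlg) (g : hom b c) (f : hom a b) :
  alg_to_elgot_map (g \o f) = elgot_comp (alg_to_elgot_map g) (alg_to_elgot_map f).
Proof. now apply sig_ext. Qed.

Definition alg_to_elgot : Functor DelayAlg Elgot :=
  @MkFunctor DelayAlg Elgot alg_elgot alg_to_elgot_map
    alg_to_elgot_map_id alg_to_elgot_map_comp.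

(** * The two functors are mutually inverse *)

Lemma elgot_operator_ext (S : Monad C) (D E : ElgotOperator H S) :
  (forall (X Y : C) (f : hom X (S (Y ⊕ X))), dagger D f = dagger E f) -> D = E.
Proof.
  destruct D as [d d1 d2 d3 d4], E as [e e1 e2 e3 e4]; simpl; intros Heq.
  assert (d = e) as ->.
  { apply functional_extensionality_dep; intros X.
    apply functional_extensionality_dep; intros Y.
    apply functional_extensionality, Heq. }
  f_equal; apply proof_irrelevance.
Qed.

Lemma alg_elgot_alg_map (a : DelayAlg) : elgot_alg_map (alg_elgot a) = alg_rho a.
Proof.
  apply monad_morphism_ext. intros X.
  change (alg_rho a X \o coitn (alg_has_nu a) (outn (alg_has_nu a) X) = alg_rho a X).
  now rewrite coitn_outn, comp_id_r.
Qed.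

(** Sharing the carriers [m] and [n] makes the equations between operators well typed, so they can
    be substituted. *)
Lemma elgot_arrow_ext (m n : omega_monads H)
    (D D' : ElgotOperator H (proj1_sig m)) (E E' : ElgotOperator H (proj1_sig n))
    (f : elgot_hom (MkOmegaElgotMonad D) (MkOmegaElgotMonad E))
    (g : elgot_hom (MkOmegaElgotMonad D') (MkOmegaElgotMonad E')) :
  D = D' -> E = E' -> proj1_sig f = proj1_sig g ->
  arrow (A := Elgot) f = arrow (A := Elgot) g.
Proof. intros <- <- Efg. now rewrite (sig_ext (x := f) (y := g) Efg). Qed.

Lemma alg_to_elgot_to_alg : functor_comp alg_to_elgot elgot_to_alg = functor_id Elgot.
Proof.
  apply functor_ext. intros [m D] [n E] f. apply elgot_arrow_ext.
  - apply elgot_operator_ext; intros X Y g. apply iter_out_coitn.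
  - apply elgot_operator_ext; intros X Y g. apply iter_out_coitn.
  - reflexivity.
Qed.

(** Algebras are given by constructors so that equal structure maps can be substituted; the laws
    then agree by proof irrelevance. *)
Lemma delay_alg_arrow_ext (m n : omega_monads H)
    (r r' : hom (nu_triple H m) m) (s s' : hom (nu_triple H n) n)
    ru r'u rm r'm su s'u sm s'm rd r'd sd s'd :
  let a := exist _ (MkEMAlgebra (alg_map := r) ru rm) rd : DelayAlg in
  let a' := exist _ (MkEMAlgebra (alg_map := r') r'u r'm) r'd : DelayAlg in
  let b := exist _ (MkEMAlgebra (alg_map := s) su sm) sd : DelayAlg in
  let b' := exist _ (MkEMAlgebra (alg_map := s') s'u s'm) s'd : DelayAlg in
  forall (f : hom a b) (g : hom a' b'),
  r = r' -> s = s' -> proj1_sig f = proj1_sig g -> arrow f = arrow g.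
Proof.
  intros a a' b b' f g Er Es Efg. subst r' s'.
  destruct (proof_irrelevance _ ru r'u), (proof_irrelevance _ rm r'm).
  destruct (proof_irrelevance _ su s'u), (proof_irrelevance _ sm s'm).
  destruct (proof_irrelevance _ rd r'd), (proof_irrelevance _ sd s'd).
  now rewrite (sig_ext (x := f) (y := g) Efg).
Qed.

Lemma elgot_to_alg_to_elgot : functor_comp elgot_to_alg alg_to_elgot = functor_id DelayAlg.
Proof.
  apply functor_ext. intros a b f.
  (* Destructing [a] and [b] afterwards turns these into equations for [r] and [s]. *)
  pose proof (alg_elgot_alg_map a) as Ea. pose proof (alg_elgot_alg_map b) as Eb.
  destruct a as [ [m r ru rm] rd], b as [ [n s su sm] sd].
  apply delay_alg_arrow_ext; [ exact Ea | exact Eb | reflexivity ].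
Qed.

End Functors.
End ElgotAlgebras.

Theorem theorem5p15 (C : Category) (H : FiniteCoproducts C) :
  isomorphic_categories
    (@omega_elgot_monads C H)
    (@full_subcategory (@EM_category (@omega_monads C H) (@nu_triple C H))
       (@delay_cancellation C H)).
Proof.
  exists (elgot_to_alg H), (alg_to_elgot H).
  split; [ apply alg_to_elgot_to_alg | apply elgot_to_alg_to_elgot ].
Qed.
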